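(* The logic of the class of all models $\mathfrak{M}=\langle W,\langle\mathcal{N}_i\rangle_{i\in I},V\rangle$ in which each $\mathcal{N}_i(w)$ ($i\in I$, $w\in W$) is closed under arbitrary intersections (that is, $\bigcap\mathcal{Y}\in\mathcal{N}_i(w)$ for every non-empty, possibly infinite, $\mathcal{Y}\subseteq\mathcal{N}_i(w)$) is axiomatized by the system obtained from $\mathbf{B}$ by replacing the schema (B1) with its unrestricted counterpart (C$_G$): $(\square_G\varphi\wedge\square_H\psi)\rightarrow\square_{G\cup H}(\varphi\wedge\psi)$, for all groups $G,H$ (not necessarily disjoint) and all $\varphi,\psi\in\mathfrak{L}$.
   Context: Fix a (finite or infinite) index set $I$ and a countable set $\mathfrak{P}$ of propositional variables. A group is a non-empty finite subset of $I$; $G,H,J$ always range over groups. Language: $\mathfrak{L}$ is generated from $\mathfrak{P}$ and the constants $\bot,\top$ by the classical connectives ($\bot,\neg,\vee$ primitive, the others and $\top$ defined as usual) and the unary modal operators $\square_G$, one for each group $G$. Write $\square_i$ for $\square_{\{i\}}$. Models: a model is $\mathfrak{M}=\langle W,\langle\mathcal{N}_i\rangle_{i\in I},V\rangle$ with $W\neq\emptyset$, $\mathcal{N}_i:W\to\wp(\wp(W))$ for each $i\in I$, and $V:\mathfrak{P}\to\wp(W)$. For a group $G=\{i_1,\ldots,i_n\}$, $\mathcal{N}_G(w)=\{X_{i_1}\cap\cdots\cap X_{i_n}\mid X_{i_j}\in\mathcal{N}_{i_j}(w)\text{ for each }j\}$. Truth at a world is defined as usual for variables and classical connectives, and $\mathfrak{M},w\models\square_G\varphi$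 iff $\|\varphi\|^{\mathfrak{M}}\in\mathcal{N}_G(w)$, where $\|\varphi\|^{\mathfrak{M}}=\{w\in W\mid\mathfrak{M},w\models\varphi\}$. For a class of models, $\Gamma\Vdash\varphi$ means: at every world of every model in the class at which all members of $\Gamma$ are true, $\varphi$ is true. The base system $\mathbf{B}$ consists of any sound and complete axiomatization of classical propositional logic, all instances in $\mathfrak{L}$ of (B1) $(\square_G\varphi\wedge\square_H\psi)\rightarrow\square_{G\cup H}(\varphi\wedge\psi)$, where $G\cap H=\emptyset$; (B2) $\square_{G\cup H}\top\rightarrow\square_G\top$; (B3) $(\square_G\varphi\wedge\square_{G\cup H\cup J}\varphi)\rightarrow\square_{G\cup H}\varphi$; (B4) $(\square_G\varphi\wedge\square_H(\varphi\vee\psi))\rightarrow\square_{G\cup H}\varphi$; and the rules (RE) if $\varphi\vdash\psi$ and $\psi\vdash\varphi$, then $\square_G\varphi\vdash\square_G\psi$; (MP) if $\vdash\varphi$ and $\vdash\varphi\rightarrow\psi$, then $\vdash\psi$. Systems obtained by adding or replacing axioms keep both rules. A theorem of a system is a formula derivable from its axioms by the rules; $\Gamma\vdash\varphi$ iff there are $\psi_1,\ldots,\psi_n\in\Gamma$ ($n\ge 0$) such that $(\psi_1\wedge\cdots\wedge\psi_n)\rightarrow\varphi$ is a theorem. The logic of a class of models is axiomatized by a system if the system is sound and strongly complete for the class: for all $\Gamma\subseteq\mathfrak{L}$, $\varphi\in\mathfrak{L}$, $\Gamma\vdash\varphi$ iff $\Gamma\Vdash\varphi$ over the class. *)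

(* Defs.v *)
From mathcomp Require Import all_boot.
From mathcomp Require Import finmap.
From mathcomp Require Import boolp classical_sets.
From Stdlib Require List.

Set Implicit Arguments.
Unset Strict Implicit.
Unset Printing Implicit Defensive.

Local Open Scope fset_scope.
Local Open Scope classical_set_scope.

Definition group (I : choiceType) := {G : {fset I} | G != fset0}.

Lemma groupU_subproof (I : choiceType) (G H : group I) :
  (val G `|` val H)%fset != fset0.
Proof. by rewrite fsetU_eq0 negb_and (valP G). Qed.

Definition groupU (I : choiceType) (G H : group I) : group I :=
  Sub (val G `|` val H)%fset (groupU_subproof G H).

Inductive form (I : choiceType) (P : countType) : Type :=
| Var of P
| Bot
| Neg of form I P
| Or of form I P & form I P
| Box of group I & form I P.

Arguments Var {I P} p.
Arguments Bot {I P}.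

Section Syntax.
Variables (I : choiceType) (P : countType).
Implicit Types (phi psi : form I P) (G H J : group I).

Definition Top : form I P := Neg Bot.
Definition And phi psi := Neg (Or (Neg phi) (Neg psi)).
Definition Imp phi psi := Or (Neg phi) psi.

End Syntax.

Arguments Top {I P}.

(* The field [nbhd] gives N_i; group neighbourhoods are derived from it. *)
Record model (I : choiceType) (P : countType) : Type := Model {
  world : Type;
  world_inhabited : inhabited world;
  nbhd : I -> world -> set (set world);
  valuation : P -> set world }.

Section Semantics.
Variables (I : choiceType) (P : countType).

(* The values of [X] outside [G] are irrelevant. *)
Definition group_nbhd (M : model I P) (G : group I) (w : world M) :
    set (set (world M)) :=
  [set Y | exists2 X : I -> set (world M),
     (forall i, i \in val G -> nbhd i w (X i)) &
     Y = \bigcap_(i in [set` val G]) X i].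

Fixpoint sat (M : model I P) (w : world M) (phi : form I P) : Prop :=
  match phi with
  | Var p => valuation p w
  | Bot => False
  | Neg a => ~ sat w a
  | Or a b => sat w a \/ sat w b
  | Box G a => group_nbhd G w [set u | sat u a]
  end.

(* Classes of models are given by [model I P -> Prop] instead of
   [set (model I P)]: the latter would force the universe of [world] to be
   strictly below that of [set], excluding worlds of type [set _]. *)
Definition entails (C : model I P -> Prop) (Gamma : set (form I P))
    (phi : form I P) : Prop :=
  forall (M : model I P), C M -> forall w : world M,
    (forall psi, Gamma psi -> sat w psi) -> sat w phi.

Definition bigcap_closed (M : model I P) : Prop :=
  forall (i : I) (w : world M) (Y : set (set (world M))),
    Y !=set0 -> Y `<=` nbhd i w -> nbhd i w (\bigcap_(X in Y) X).

End Semantics.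

Section Systems.
Variables (I : choiceType) (P : countType).
Local Notation form := (form I P).
Implicit Types (phi psi : form) (G H J : group I) (A K : set form).

(* Variables and boxed formulas are the propositional atoms; [v] is only
   consulted on those. *)
Fixpoint pc_eval (v : form -> bool) phi : bool :=
  match phi with
  | Var _ | Box _ _ => v phi
  | Bot => false
  | Neg a => ~~ pc_eval v a
  | Or a b => pc_eval v a || pc_eval v b
  end.

Definition tautology phi : Prop := forall v, pc_eval v phi.

Inductive mp_derivable (K : set form) : form -> Prop :=
| mp_axiom phi : K phi -> mp_derivable K phi
| mp_rule phi psi :
    mp_derivable K phi -> mp_derivable K (Imp phi psi) -> mp_derivable K psi.

(* [K] is a sound and complete axiomatization of classical propositional
   logic in the modal language. *)
Definition pc_axiomatization (K : set form) : Prop :=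
  forall phi, mp_derivable K phi <-> tautology phi.

Definition CG : set form :=
  [set chi | exists G H phi psi,
     chi = Imp (And (Box G phi) (Box H psi)) (Box (groupU G H) (And phi psi))].

Definition B2 : set form :=
  [set chi | exists G H, chi = Imp (Box (groupU G H) Top) (Box G Top)].

Definition B3 : set form :=
  [set chi | exists G H J phi,
     chi = Imp (And (Box G phi) (Box (groupU (groupU G H) J) phi))
               (Box (groupU G H) phi)].

Definition B4 : set form :=
  [set chi | exists G H phi psi,
     chi = Imp (And (Box G phi) (Box H (Or phi psi))) (Box (groupU G H) phi)].

Definition system_CG (K : set form) : set form :=
  K `|` CG `|` B2 `|` B3 `|` B4.

(* In the rule RE the premises "phi |- psi" and "psi |- phi" and the conclusion
   are given as theoremhood of the corresponding implications. *)
Inductive thm (A : set form) : form -> Prop :=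
| thm_axiom phi : A phi -> thm A phi
| thm_RE G phi psi :
    thm A (Imp phi psi) -> thm A (Imp psi phi) ->
    thm A (Imp (Box G phi) (Box G psi))
| thm_MP phi psi : thm A phi -> thm A (Imp phi psi) -> thm A psi.

Definition derives A (Gamma : set form) phi : Prop :=
  exists2 s : seq form,
    List.Forall Gamma s & thm A (Imp (foldr (@And I P) Top s) phi).

Definition axiomatizes A (C : model I P -> Prop) : Prop :=
  forall (Gamma : set form) phi, derives A Gamma phi <-> entails C Gamma phi.

End Systems.

(* Main.v *)
Require Import Defs.
From mathcomp Require Import all_boot.
From mathcomp Require Import finmap.
From mathcomp Require Import boolp classical_sets.
From Stdlib Require List.

(**
Soundness is a matter of choosing neighbourhoods agent by agent: for [CG], an
agent common to both groups uses the intersection of its two neighbourhoods; for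
[B3] and [B4], an agent outside [G] uses the neighbourhood it contributes
to the other group, which includes the truth set at hand
([group_nbhd_extend]).

For strong completeness, a world is a pair [(v, f)]: a propositional valuation
[v] making every theorem true (that is, a maximal consistent set), and a selector
[f] naming one member [f p] of [G] for each pair [p = (G, phi)].  When
[Box G phi] holds at [w], each [i] in [G] receives as neighbourhood its [share]:
the worlds where [phi] holds or where [f (G, phi)] is not [i].  Since at each world
exactly one member is selected, the shares of all members of [G] intersect exactly
in the truth set of [phi], and those of a proper subset of [G] do not, unless
[phi] holds everywhere.  The neighbourhoods of [i] are the intersections
of non-empty families of shares, hence are closed under arbitrary intersections.

What has to be shown is that no unwanted truth set becomes a neighbourhood of a
group ([truth_box]).  Suppose that shares, at least one for each member of [H],
intersect exactly in the truth set of [a].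
- At a valuation refuting [a], let the selector avoid the shares in the
  intersection whenever it can.  The resulting world lies outside some share of
  a pair [(G, b)] in the family, so for that pair it could not avoid: all of [G]
  takes part, whence [G] is included in [H], and [b] fails there.  By compactness
  ([derives_complete]), finitely many such [b] imply [a].
- At a valuation satisfying [a], let the selector pick the owner of a given
  share: so [a] implies the content of every share in the family.
The axioms turn these two facts into the truth of [Box H a] ([box_criterion]).
*)

Set Implicit Arguments.
Unset Strict Implicit.
Unset Printing Implicit Defensive.

Local Open Scope classical_set_scope.

(** * Soundness *)

Section Soundness.
Variables (I : choiceType) (P : countType).
Implicit Types (phi psi : form I P) (G H : group I) (M : model I P).

(** Soundness of tautologies: satisfaction at a world is a propositional
    valuation. *)
Lemma sat_pc_eval M (w : world M) phi :
  pc_eval (fun a => `[<sat w a>]) phi <-> sat w phi.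
Proof.
elim: phi => [p||a IHa|a IHa b IHb|G a _] /=.
- by split=> /asboolP.
- by [].
- by split=> [/negP na /IHa|na]; last apply/negP => /IHa.
- by split=> [/orP|] [/IHa|/IHb] h; [left|right|apply/orP; left|apply/orP; right].
- by split=> /asboolP.
Qed.

Lemma sat_Imp M (w : world M) phi psi :
  sat w (Imp phi psi) <-> (sat w phi -> sat w psi).
Proof.
by split=> /= [[] // |h]; have [/h|] := pselect (sat w phi); [right|left].
Qed.

Lemma sat_And M (w : world M) phi psi :
  sat w (And phi psi) <-> sat w phi /\ sat w psi.
Proof.
split=> /= [h|[a b] []//].
by split; apply: contrapT => h'; apply: h; [left|right].
Qed.

Lemma sat_conj M (w : world M) (s : seq (form I P)) :
  sat w (foldr (@And I P) Top s) <-> List.Forall (sat w) s.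
Proof.
elim: s => [|a s IH]; first by split=> // _ [].
rewrite [foldr _ _ _]/= sat_And IH; split=> [[]|h]; first by constructor.
by inversion h.
Qed.

Lemma bigcap_closedI M (i : I) (w : world M) (X Y : set (world M)) :
  bigcap_closed M -> nbhd i w X -> nbhd i w Y -> nbhd i w (X `&` Y).
Proof.
move=> CM NX NY.
have -> : X `&` Y = \bigcap_(Z in [set X; Y]) Z.
  apply/seteqP; split=> [u [Xu Yu] Z [] -> //|u h].
  by split; apply: h; [left|right].
by apply: CM => [|Z [] -> //]; exists X; left.
Qed.

Lemma sound_CG M (w : world M) chi :
  bigcap_closed M -> CG chi -> sat w chi.
Proof.
move=> CM [G [H [a [b ->]]]]; apply/sat_Imp => /sat_And [[X NX eX] [Y NY eY]].
exists (fun i => if i \in val G then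
                   if i \in val H then X i `&` Y i else X i else Y i).
  move=> i /=; rewrite in_fsetU; case: (boolP (i \in val G)) => iG /=.
    by case: ifP => iH _; [apply: bigcap_closedI; auto|auto].
  exact: NY.
apply/seteqP; split=> u.
  move=> /sat_And [ua ub].
  have ua' : [set u | sat u a] u by []. have ub' : [set u | sat u b] u by [].
  rewrite eX in ua'; rewrite eY in ub' => i /=; rewrite in_fsetU.
  case: (boolP (i \in val G)) => iG /=.
    by case: ifP => iH _; [split; [exact: ua'|exact: ub']|exact: ua'].
  exact: ub'.
move=> h; apply/sat_And; split.
  suff : [set u | sat u a] u by [].
  rewrite eX => i /= iG; have := h i; rewrite /= in_fsetU iG.
  by case: ifP => _ /(_ isT) // [].
suff : [set u | sat u b] u by [].
rewrite eY => i /= iH; have := h i; rewrite /= in_fsetU iH orbT.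
by case: ifP => _ /(_ isT) // [].
Qed.

Lemma sound_B2 M (w : world M) chi : B2 chi -> sat w chi.
Proof.
move=> [G [H ->]]; apply/sat_Imp => -[X NX eX].
exists X => [i iG|]; first by apply: NX; rewrite /= in_fsetU iG.
rewrite eX; apply/seteqP; split=> u h i iG.
  by apply: h; rewrite /= in_fsetU iG.
suff : [set u : world M | sat u Top] u by rewrite eX; apply.
by move=> /=.
Qed.

(** Common core of the soundness of [B3] and [B4]: the new members intersect
    the given neighbourhood with supersets of it, which leaves it unchanged. *)
Lemma group_nbhd_extend M (w : world M) G H (A : set (world M)) :
  (forall i, i \in val G -> i \in val H) -> group_nbhd G w A ->
  (forall i, i \in val H -> exists2 Y, nbhd i w Y & A `<=` Y) ->
  group_nbhd H w A.
Proof.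
move=> GH [X NX ->] hH.
have /choice[Y hY] i : exists Y,
    i \in val H -> nbhd i w Y /\ \bigcap_(i in [set` val G]) X i `<=` Y.
  have [/hH[Y]|iH] := boolP (i \in val H); first by exists Y.
  by exists setT.
exists (fun i => if i \in val G then X i else Y i).
  by move=> i /hY[NY _]; case: ifP; auto.
apply/seteqP; split=> u h i /= iH.
  by case: ifP => iG; [exact: h|exact: (hY i iH).2].
by have := h i (GH _ iH); rewrite (iH : i \in val G).
Qed.

Lemma group_nbhd_le M (w : world M) G A i :
  group_nbhd G w A -> i \in val G -> exists2 Y, nbhd i w Y & A `<=` Y.
Proof. by move=> [X NX ->] iG; exists (X i); [exact: NX|move=> u; apply]. Qed.

Lemma sound_B3 M (w : world M) chi : B3 chi -> sat w chi.
Proof.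
move=> [G [H [J [a ->]]]]; apply/sat_Imp => /sat_And [NG NGHJ].
apply: (group_nbhd_extend _ NG) => i iG; first by rewrite /= in_fsetU iG.
by apply: (group_nbhd_le NGHJ); rewrite /= in_fsetU; apply/orP; left.
Qed.

Lemma sound_B4 M (w : world M) chi : B4 chi -> sat w chi.
Proof.
move=> [G [H [a [b ->]]]]; apply/sat_Imp => /sat_And [NG NH].
apply: (group_nbhd_extend _ NG) => i /=; rewrite in_fsetU; first by move->.
case/orP => [iG|iH]; first exact: group_nbhd_le iG.
have [Y NY abY] := group_nbhd_le NH iH.
by exists Y => // u ua; apply: abY; left.
Qed.

Lemma sound_thm (K : set (form I P)) :
  pc_axiomatization K -> forall M, bigcap_closed M ->
  forall phi, thm (system_CG K) phi -> forall w : world M, sat w phi.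
Proof.
move=> hK M CM phi; elim=> {phi} [phi Aphi w|G a b _ ab _ ba w|a b _ ha _ hab w].
- case: Aphi => [[[[Kphi|]|]|]|].
  + by apply/sat_pc_eval; move: (fun v => (hK _).1 (mp_axiom Kphi) v); apply.
  + exact: sound_CG.
  + exact: sound_B2.
  + exact: sound_B3.
  + exact: sound_B4.
- apply/sat_Imp => /=.
  suff -> : [set u : world M | sat u a] = [set u | sat u b] by [].
  by apply/seteqP; split=> u; apply/sat_Imp; [exact: ab|exact: ba].
- by apply: (sat_Imp w a b).1 (ha w).
Qed.

End Soundness.

(** * Propositional reasoning and Lindenbaum's lemma *)

Section Lindenbaum.
Variables (I : choiceType) (P : countType) (K A : set (form I P)).
Hypotheses (hK : pc_axiomatization K) (KA : K `<=` A).
Local Notation form := (form I P).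
Local Notation conj := (foldr (@And I P) Top).
Implicit Types (phi psi a b c : form) (s : seq form) (Gamma : set form).

Lemma pc_eval_Imp v a b : pc_eval v (Imp a b) = (pc_eval v a ==> pc_eval v b).
Proof. by rewrite /= implybE. Qed.

Lemma pc_eval_And v a b : pc_eval v (And a b) = pc_eval v a && pc_eval v b.
Proof. by rewrite /= negb_or !negbK. Qed.

Lemma pc_eval_conj v s : pc_eval v (conj s) = all (pc_eval v) s.
Proof. by elim: s => // a s IH; rewrite [conj _]/= pc_eval_And IH. Qed.

Lemma thm_tautology phi : tautology phi -> thm A phi.
Proof.
move=> /hK; elim=> [a Ka|a b _ ha _ hab]; first exact/thm_axiom/KA.
exact: thm_MP ha hab.
Qed.

Lemma thm_pc1 a c :
  thm A a -> (forall v, pc_eval v a -> pc_eval v c) -> thm A c.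
Proof.
move=> ha hc; apply: (thm_MP ha); apply: thm_tautology => v.
by rewrite pc_eval_Imp; apply/implyP/hc.
Qed.

Lemma thm_pc2 a b c : thm A a -> thm A b ->
  (forall v, pc_eval v a -> pc_eval v b -> pc_eval v c) -> thm A c.
Proof.
move=> ha hb hc; apply: (thm_MP ha); apply: (thm_pc1 hb) => v vb.
by rewrite pc_eval_Imp; apply/implyP => va; exact: hc.
Qed.

Lemma derives_hyp Gamma a : Gamma a -> derives A Gamma a.
Proof.
move=> Ga; exists [:: a]; first by constructor.
by apply: thm_tautology => v; rewrite pc_eval_Imp pc_eval_conj /= andbT implybb.
Qed.

Lemma derives_thm Gamma a : thm A a -> derives A Gamma a.
Proof.
move=> ha; exists [::] => //.
by apply: (thm_pc1 ha) => v va; rewrite pc_eval_Imp va implybT.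
Qed.

Lemma derives_pc2 Gamma a b c : derives A Gamma a -> derives A Gamma b ->
  (forall v, pc_eval v a -> pc_eval v b -> pc_eval v c) -> derives A Gamma c.
Proof.
move=> [s Gs ha] [t Gt hb] hc; exists (s ++ t).
  by apply/List.Forall_app.
apply: (thm_pc2 ha hb) => v; rewrite !pc_eval_Imp !pc_eval_conj all_cat.
by move=> /implyP va /implyP vb; apply/implyP => /andP[/va ? /vb ?]; exact: hc.
Qed.

(** Deduction theorem.  The hypotheses are discharged one at a time, those
    from [Gamma] being put back afterwards. *)
Lemma derives_deduction Gamma a b :
  derives A (Gamma `|` [set a]) b -> derives A Gamma (Imp a b).
Proof.
move=> [s]; elim: s b => [|c s IH] b Gs hb.
  exists [::] => //; apply: (thm_pc1 hb) => v; rewrite !pc_eval_Imp /=.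
  by move=> ->; rewrite implybT.
inversion Gs as [|? ? Gc Gs']; subst.
have /IH /= : thm A (Imp (conj s) (Imp c b)).
  apply: (thm_pc1 hb) => v; rewrite !pc_eval_Imp [conj _]/= pc_eval_And.
  by case: (pc_eval v c); case: (pc_eval v (conj s)).
move=> /(_ Gs') hd; case: Gc => [Gc|ca].
  apply: (derives_pc2 hd (derives_hyp Gc)) => v; rewrite !pc_eval_Imp.
  by case: (pc_eval v c); case: (pc_eval v a).
apply: (derives_pc2 hd hd) => v; rewrite !pc_eval_Imp ca.
by case: (pc_eval v a).
Qed.

Definition theory_valuation (v : form -> bool) :=
  forall a, thm A a -> pc_eval v a.

(** Lindenbaum's lemma, with valuations for maximal consistent sets.  A set [M] including [Gamma] and
    maximal among those not deriving [phi] contains [a] exactly when it does not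
    derive [a -> phi]; hence it commutes with the connectives, and its
    characteristic function is the separating valuation. *)
Lemma derives_complete Gamma phi :
  (forall v, theory_valuation v -> (forall a, Gamma a -> pc_eval v a) ->
             pc_eval v phi) ->
  derives A Gamma phi.
Proof.
move=> hv; apply: contrapT => nphi.
have [|X [nX maxX]] := @Zorn_bigcup _
    [set X | ~ derives A (Gamma `|` X) phi].
  move=> F FP Ftot [s Fs hs].
  have [X [FX sX]] : exists X, (X = set0 \/ F X) /\
      List.Forall (Gamma `|` X) s.
    elim: Fs => [|a t ha _ [X [FX tX]]]; first by exists set0; split; [left|].
    case: ha => [Ga|[Y FY Ya]].
      by exists X; split=> //; constructor => //; left.
    suff [XY|YX] : X `<=` Y \/ Y `<=` X.
    - exists Y; split; first by right.
      constructor; first by right.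
      by apply: List.Forall_impl tX => b [|/XY]; [left|right].
    - by exists X; split=> //; constructor => //; right; exact: YX.
    case: FX => [->|FX]; first by left.
    exact: Ftot.
  case: FX sX => [->|FX] sX; last by apply: (FP X FX); exists s.
  by apply: nphi; exists s => //; rewrite setU0 in sX.
set M := Gamma `|` X in nX.
have inM a : ~ M a -> derives A M (Imp a phi).
  move=> nMa; apply: derives_deduction; apply: contrapT => h.
  apply: (maxX (X `|` [set a])); last by rewrite /= setUA.
  split=> [|XaX]; first by left.
  by apply: nMa; right; apply: XaX; right.
have M_closed a b c : derives A M a -> derives A M b ->
    (forall v, pc_eval v a -> pc_eval v b -> pc_eval v c) -> M c.
  move=> Ma Mb h; apply: contrapT => /inM nc; apply: nX.
  apply: (derives_pc2 (derives_pc2 Ma Mb h) nc) => v vc.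
  by rewrite pc_eval_Imp vc.
have nMphi : ~ M phi by move=> /derives_hyp.
pose v a := `[<M a>].
have vM a : pc_eval v a = `[<M a>].
  elim: a => [//||a IHa|a IHa b IHb|//] /=.
  - apply/esym/asboolP => /derives_hyp Mb; apply: nMphi.
    exact: (M_closed _ _ _ Mb Mb).
  - rewrite IHa; apply/negP/asboolP => [nMa|Mna /asboolP Ma].
    + have na : ~ M a by move=> /asboolP.
      apply: contrapT => /inM nna; apply: nMphi.
      apply: (M_closed _ _ _ (inM _ na) nna) => u; rewrite !pc_eval_Imp /=.
      by case: (pc_eval u a).
    + apply: nMphi; apply: (M_closed _ _ _ (derives_hyp Ma) (derives_hyp Mna)) => u /=.
      by case: (pc_eval u a).
  - rewrite IHa IHb; apply/orP/asboolP => [[]/asboolP/derives_hyp h|Mab].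
    + by apply: (M_closed _ _ _ h h) => u /= ->.
    + by apply: (M_closed _ _ _ h h) => u /= ->; rewrite orbT.
    + apply: contrapT => /not_orP[nMa nMb]; apply: nMphi.
      have na : ~ M a by move=> /asboolP.
      have nb : ~ M b by move=> /asboolP.
      have Mnab : M (Imp (Or a b) phi).
        apply: (M_closed _ _ _ (inM _ na) (inM _ nb)) => u.
        by rewrite !pc_eval_Imp /=; case: (pc_eval u a).
      apply: (M_closed _ _ _ (derives_hyp Mab) (derives_hyp Mnab)) => u.
      by rewrite pc_eval_Imp => ->.
have /asboolP // : `[<M phi>].
rewrite -vM; apply: hv => a h; rewrite vM; apply/asboolP; last by left.
by apply: (M_closed a a) => //; exact: derives_thm.
Qed.

Lemma thm_complete phi :
  (forall v, theory_valuation v -> pc_eval v phi) -> thm A phi.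
Proof.
move=> hv; have [|s s0 hs] := @derives_complete set0 phi.
  by move=> v vA _; exact: hv.
case: s s0 hs => [_ hs|a s s0]; last by inversion s0.
by apply: (thm_pc1 hs) => v; rewrite pc_eval_Imp.
Qed.

End Lindenbaum.

(** * Deriving the box of a group from other boxes *)

Section Canonical.
Variables (I : choiceType) (P : countType) (K : set (form I P)).
Hypothesis hK : pc_axiomatization K.
Local Notation form := (form I P).
Local Notation A := (system_CG K).
Local Notation conj := (foldr (@And I P) Top).
Implicit Types (phi psi a b : form) (G H : group I).

Lemma K_sub_system : K `<=` A.
Proof. by move=> a Ka; do 4 left. Qed.

Section BoxLaws.
Variable v : form -> bool.
Hypothesis v_thm : theory_valuation A v.

Lemma thm_Imp_eval a b : thm A (Imp a b) -> pc_eval v a -> pc_eval v b.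
Proof. by move=> /v_thm; rewrite pc_eval_Imp => /implyP. Qed.

Lemma box_equiv G a b :
  thm A (Imp a b) -> thm A (Imp b a) -> v (Box G a) -> v (Box G b).
Proof. by move=> ab ba; apply: (@thm_Imp_eval (Box G a) (Box G b)); exact: thm_RE. Qed.

Lemma box_and G H a b :
  v (Box G a) -> v (Box H b) -> v (Box (groupU G H) (And a b)).
Proof.
move=> va vb; apply: (@thm_Imp_eval (And (Box G a) (Box H b)) (Box _ _)).
  by apply: thm_axiom; left; left; left; right; exists G, H, a, b.
by rewrite pc_eval_And /= va vb.
Qed.

Lemma box_top G H : (val G `<=` val H)%fset -> v (Box H Top) -> v (Box G Top).
Proof.
move=> GH; have -> : H = groupU G H by apply/val_inj/esym/fsetUidPr.
apply: (@thm_Imp_eval (Box _ _) (Box _ _)).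
by apply: thm_axiom; left; left; right; exists G, H.
Qed.

Lemma box_convex G H J a : (val G `<=` val H)%fset -> (val H `<=` val J)%fset ->
  v (Box G a) -> v (Box J a) -> v (Box H a).
Proof.
move=> GH HJ vG vJ.
have eH : groupU G H = H by apply/val_inj/fsetUidPr.
have eJ : groupU H J = J by apply/val_inj/fsetUidPr.
rewrite -eH; apply: (@thm_Imp_eval (And (Box G a) (Box (groupU (groupU G H) J) a)) (Box _ _)).
  by apply: thm_axiom; left; right; exists G, H, J, a.
by rewrite pc_eval_And /= eH eJ vG vJ.
Qed.

(** [B4] read through the equivalence of [b] with [Or a b]. *)
Lemma box_join G H a b : thm A (Imp a b) ->
  v (Box G a) -> v (Box H b) -> v (Box (groupU G H) a).
Proof.
move=> ab vG vH; apply: (@thm_Imp_eval (And (Box G a) (Box H (Or a b))) (Box _ _)).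
  by apply: thm_axiom; right; exists G, H, a, b.
rewrite pc_eval_And /= vG; apply: box_equiv vH.
  apply: (thm_tautology hK K_sub_system) => u /=.
  by case: (pc_eval u a); case: (pc_eval u b).
apply: (thm_pc1 hK K_sub_system ab) => u /=.
by case: (pc_eval u a); case: (pc_eval u b).
Qed.

(** The condition under which [box_join] lets a group that has [a] recruit [i]. *)
Definition joined a (i : I) :=
  exists G b, [/\ i \in val G, v (Box G b) & thm A (Imp a b)].

Lemma box_recruit G a (r : seq I) : v (Box G a) ->
  (forall i, i \in r -> joined a i) ->
  exists J, [/\ (val G `<=` val J)%fset, {subset r <= val J} & v (Box J a)].
Proof.
move=> vG; elim: r => [|i r IH] hr; first by exists G.
have [|J [GJ rJ vJ]] := IH; first by move=> j jr; apply: hr; rewrite inE jr orbT.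
have [H [b [iH vH ab]]] := hr i (mem_head _ _).
exists (groupU J H); split; last exact: box_join vH.
  exact: fsubset_trans GJ (fsubsetUl _ _).
move=> j; rewrite inE /= in_fsetU => /predU1P[->|/rJ ->//].
by rewrite iH orbT.
Qed.

Lemma box_conj H (s : seq form) : s <> [::] ->
  List.Forall (fun b => exists2 G, (val G `<=` val H)%fset & v (Box G b)) s ->
  exists2 G, (val G `<=` val H)%fset & v (Box G (conj s)).
Proof.
move=> + hs; elim: hs => // a t [G GH va] ht IH _.
case: t ht IH => [_ _|b t ht IH].
  exists G => //; apply: box_equiv va; apply: (thm_tautology hK K_sub_system);
  by move=> u; rewrite pc_eval_Imp ?pc_eval_And /= ?andbT implybb.
have [//|J JH vJ] := IH.
exists (groupU G J); first by rewrite fsubUset GH JH.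
exact: box_and.
Qed.

(** The finitely many formulas from which [a] is derived have a conjunction
    equivalent to [a], so conjoining their boxes yields a box of [a] for a
    subgroup of [H].  Recruiting all members of [H] yields one for a supergroup
    of [H], and convexity [B3] the one for [H] itself. *)
Lemma box_criterion H a :
  (forall i, i \in val H -> joined a i) ->
  derives A [set b | (exists2 G, (val G `<=` val H)%fset & v (Box G b)) /\
                     thm A (Imp a b)] a ->
  v (Box H a).
Proof.
move=> jH [s sH sa].
have [G GH vG] : exists2 G, (val G `<=` val H)%fset & v (Box G a).
  case: (pselect (s = [::])) => [s0|s0].
    (* No box was used: [a] is a theorem, and so is the content of the box
       joining some member [i]; [B2] restricts that box to [i] alone. *)
    have [i iH] := fset0Pn _ (valP H).
    have [J [b [iJ vJ ab]]] := jH i iH.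
    have n0 : [fset i]%fset != fset0 by apply/fset0Pn; exists i; rewrite inE.
    have ha : thm A a.
      by apply: (thm_pc1 hK K_sub_system sa) => u; rewrite s0 pc_eval_Imp.
    exists (Sub [fset i]%fset n0); first by rewrite /= fsub1set.
    have aT b' c : thm A b' -> thm A (Imp c b').
      move=> h; apply: (thm_pc1 hK K_sub_system h) => u ub.
      by rewrite pc_eval_Imp ub implybT.
    have hT : thm A Top by apply: (thm_tautology hK K_sub_system).
    apply: (@box_equiv _ Top); [exact: aT|exact: aT|].
    apply: (@box_top _ J); first by rewrite /= fsub1set.
    apply: box_equiv vJ; first exact: aT.
    by apply: (thm_pc2 hK K_sub_system ha ab) => u ua; rewrite !pc_eval_Imp ua.
  have [|G GH vG] := @box_conj H s s0.
    by apply: List.Forall_impl sH => b [].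
  exists G => //; apply: box_equiv vG => //.
  elim: sH {sa s0} => [|b t [_ ab] _ IH].
    by apply: (thm_tautology hK K_sub_system) => u; rewrite pc_eval_Imp implybT.
  apply: (thm_pc2 hK K_sub_system ab IH) => u; rewrite !pc_eval_Imp.
  by rewrite [conj _]/= pc_eval_And; case: (pc_eval u a) => //= -> ->.
have [J [GJ HJ vJ]] := box_recruit vG jH.
by apply: box_convex vG vJ => //; apply/fsubsetP.
Qed.

End BoxLaws.

(** * The canonical model *)

Definition selector (f : group I * form -> I) := forall p, f p \in val p.1.

(** All the freedom in the choice of selectors: [Q p i] is the wish that [i] be
    selected at [p], and every wish that some member can fulfil is fulfilled. *)
Lemma selector_exists (Q : group I * form -> I -> Prop) :
  exists2 f, selector f &
    forall p i, i \in val p.1 -> Q p i -> Q p (f p).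
Proof.
have /choice[f hf] p : exists i, i \in val p.1 /\
    ((exists2 j, j \in val p.1 & Q p j) -> Q p i).
  have [[j jp Qj]|nQ] := pselect (exists2 j, j \in val p.1 & Q p j).
    by exists j.
  by have [i ip] := fset0Pn _ (valP p.1); exists i.
exists f => [p|p i ip Qi]; first by have [] := hf p.
by apply: (hf p).2; exists i.
Qed.

Definition canon_world : Type :=
  {v : form -> bool | theory_valuation A v} *
  {f : group I * form -> I | selector f}.

Definition holds (x : canon_world) a : bool := pc_eval (sval x.1) a.

(** The share of agent [i] in the box [p]. *)
Definition share (i : I) (p : group I * form) : set canon_world :=
  [set x | sval x.2 p = i -> holds x p.2].

Definition admissible (w : canon_world) i (p : group I * form) :=
  i \in val p.1 /\ sval w.1 (Box p.1 p.2).

(** The intersections of non-empty families of admissible shares.  Such a set is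
    the intersection of all the admissible shares that include it; in this form
    no family is mentioned, and closure under intersections is immediate. *)
Definition canon_nbhd (i : I) (w : canon_world) : set (set canon_world) :=
  [set Y | (exists2 p, admissible w i p & Y `<=` share i p) /\
     forall x, (forall p, admissible w i p -> Y `<=` share i p -> share i p x) ->
       Y x].

Lemma canon_nbhd_bigcap i w (F : set (set canon_world)) :
  F !=set0 -> F `<=` canon_nbhd i w -> canon_nbhd i w (\bigcap_(Y in F) Y).
Proof.
move=> [Y FY] FN; split.
  have [[p wp Yp] _] := FN Y FY.
  by exists p => // x /(_ Y FY); exact: Yp.
move=> x hx Z FZ; have [_] := FN Z FZ; apply=> p wp Zp.
by apply: hx => // y /(_ Z FZ); exact: Zp.
Qed.

Definition canon_model (i0 : inhabited canon_world) : model I P :=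
  Model i0 canon_nbhd (fun p => [set x | holds x (Var p)]).

Lemma share_bigcap G a :
  \bigcap_(i in [set` val G]) share i (G, a) = [set x | holds x a].
Proof.
apply/seteqP; split=> x; last by move=> h i _ _.
by move=> h; apply: (h (sval x.2 (G, a)) (svalP x.2 _)).
Qed.

(** The heart of the proof.  From right to left, the shares of the members of [H]
    in the box itself are the required neighbourhoods.  From left to right,
    suitably chosen selectors provide the hypotheses of [box_criterion]. *)
Lemma truth_box i0 (w : world (canon_model i0)) H a :
  group_nbhd H w [set x | holds x a] <-> sval w.1 (Box H a).
Proof.
split=> [[Y NY eY]|wHa]; last first.
  exists (fun i => share i (H, a)); last by rewrite share_bigcap.
  by move=> i iH; split=> [|x]; [exists (H, a)|apply].
have aY x : holds x a -> forall i, i \in val H -> Y i x.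
  by move=> xa; have : [set x | holds x a] x by []; rewrite eY.
have Ya x : (forall i, i \in val H -> Y i x) -> holds x a.
  by move=> Yx; suff : [set x | holds x a] x by []; rewrite eY.
(* At a world satisfying [a] whose selector picks [i] at [p], membership in the
   share of [i] forces the content of [p]. *)
have a_le i p : i \in val H -> admissible w i p -> Y i `<=` share i p ->
    thm A (Imp a p.2).
  move=> iH [ip _] Yp.
  have [f fs /(_ p i ip (fun=> erefl)) fp] :=
    selector_exists (fun q j => q = p -> j = i).
  apply: (thm_complete hK K_sub_system) => v vA; rewrite pc_eval_Imp.
  apply/implyP => va; pose x : canon_world := (exist _ v vA, exist _ f fs).
  by apply: (Yp x (aY x va i iH)); exact: fp.
apply: box_criterion; first exact: (svalP w.1).
  move=> i iH; have [[p [ip wp] Yp] _] := NY i iH.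
  by exists p.1, p.2; split=> //; apply: a_le Yp.
apply: (derives_complete hK K_sub_system) => v vA hv.
(* With a selector that picks outside the shares taking part in the
   intersection wherever possible, failing such a share at [p] means that all
   members of [p.1] take part in it. *)
pose used p i := [/\ i \in val H, admissible w i p & Y i `<=` share i p].
have [f fs fQ] := selector_exists (fun p i => ~ used p i).
pose x : canon_world := (exist _ v vA, exist _ f fs).
apply: (Ya x) => i iH; have [_] := NY i iH; apply=> p wp Yp /= fp.
have all_used j : j \in val p.1 -> used p j.
  move=> jp; apply: contrapT => /(fQ p j jp); apply.
  by rewrite (fp : f p = i).
apply: hv; split; last exact: a_le Yp.
exists p.1; last by have [] := wp.
by apply/fsubsetP => j /all_used [].
Qed.

Lemma truth_lemma i0 (w : world (canon_model i0)) a : sat w a <-> holds w a.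
Proof.
elim: a w => [p||a IHa|a IHa b IHb|G a IHa] w //=.
- by rewrite /holds /= IHa; split=> /negP.
- by rewrite /holds /= IHa IHb; split=> /orP.
- have -> : [set u : world (canon_model i0) | sat u a] = [set u | holds u a].
    by apply/seteqP; split=> u /IHa.
  exact: truth_box.
Qed.

Lemma completeness Gamma a :
  entails (@bigcap_closed I P) Gamma a -> derives A Gamma a.
Proof.
move=> Ga; apply: (derives_complete hK K_sub_system) => v vA vG.
have [f fs _] := selector_exists (fun _ _ => True).
pose x : canon_world := (exist _ v vA, exist _ f fs).
apply/(truth_lemma (i0 := inhabits x) x).
apply: Ga => [i w F|b /vG vb]; first exact: canon_nbhd_bigcap.
exact/truth_lemma.
Qed.

End Canonical.

Theorem theorem7 (I : choiceType) (P : countType) (K : set (form I P))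
    (hK : pc_axiomatization K) :
  axiomatizes (system_CG K) (@bigcap_closed I P).
Proof.
move=> Gamma phi; split; last exact: completeness.
move=> [s Gs hs] M CM w wG.
apply: (sat_Imp w _ _).1 (sound_thm hK CM hs w) _.
by apply/sat_conj; apply: List.Forall_impl Gs.
Qed.
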